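(* Let $H$ be a bipartite graph and let $G$ be a graph that admits a simultaneous $s$-stack $q$-queue layout. Then (i) $\mathrm{sn}(H \,\square\, G) \le s + \mathrm{dsn}(H)$; (ii) $\mathrm{sn}(H \times G) \le 2q\cdot \mathrm{dsn}(H)$; (iii) $\mathrm{sn}(H \boxtimes G) \le 2q\cdot \mathrm{dsn}(H) + s + \mathrm{dsn}(H)$.
   Context: All graphs are finite, simple and undirected. A vertex order $\sigma$ of a graph is a total order of its vertices. Two edges $(u,v)$ and $(x,y)$ cross with respect to $\sigma$ if $u <_\sigma x <_\sigma v <_\sigma y$, and nest if $u <_\sigma x <_\sigma y <_\sigma v$. A $k$-stack layout is a vertex order together with a partition of the edge set into $k$ sets (stacks) of pairwise non-crossing edges; a $k$-queue layout is a vertex order with a partition of the edges into $k$ sets (queues) of pairwise non-nested edges. The stack number $\mathrm{sn}(G)$ is the minimum $k$ such that $G$ has a $k$-stack layout. A simultaneous $s$-stack $q$-queue layout of $G$ is a single vertex order $\sigma$ together with a partition of $E(G)$ into $s$ stacks with respect to $\sigma$ and (independently) a partition of $E(G)$ into $q$ queues with respect to $\sigma$ (each edge lies in one stack and in one queue). A dispersable stack layout is a stack layout in which the edges of each stack form a matching (pairwise vertex-disjoint edges); the dispersable stack number $\mathrm{dsn}(H)$ is the minimum number of stacks in a dispersable stack layout of $H$. For graphs $A,B$, products are defined on $V(A)\times V(B)$; a pair $(v,x),(u,y)$ is an $A$-edge if $v=u$ and $(x,y)\in E(B)$, a $B$-edge if $x=y$ and $(v,u)\in E(A)$, and a direct edge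 if $(v,u)\in E(A)$ and $(x,y)\in E(B)$. The cartesian product $A\,\square\,B$ has the $A$-edges and $B$-edges; the direct product $A\times B$ has the direct edges; the strong product $A\boxtimes B$ has all three kinds. *)

(* Defs.v *)
(* [boolp] is used only to take minima of [Prop]-valued predicates on [nat]. *)
From HB Require Import structures.
From mathcomp Require Import all_boot.
From mathcomp Require Import boolp.

Set Implicit Arguments.
Unset Strict Implicit.
Unset Printing Implicit Defensive.

Record sgraph := SGraph {
  vertex :> finType;
  adj : rel vertex;
  adj_sym : symmetric adj;
  adj_irrefl : irreflexive adj }.

Arguments adj {s}.

Definition edges (G : sgraph) : {set {set G}} :=
  [set [set p.1; p.2] | p : G * G & adj p.1 p.2].

Definition bipartite (G : sgraph) : Prop :=
  exists A : {set G}, forall u v : G, adj u v -> (u \in A) != (v \in A).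

(* A vertex order is given by its non-strict relation; totality includes
   reflexivity. *)
Definition vertex_order (T : finType) (sigma : rel T) : Prop :=
  [/\ antisymmetric sigma, transitive sigma & total sigma].

Definition before (T : finType) (sigma : rel T) : rel T :=
  fun u v => (u != v) && sigma u v.

(* [crosses] and [nests] depend on which edge is called (u,v) and which (x,y);
   [is_stack] and [is_queue] quantify over both choices. *)
Definition crosses (T : finType) (sigma : rel T) (e f : {set T}) : Prop :=
  exists u v x y : T,
    [/\ e = [set u; v], f = [set x; y]
      & [/\ before sigma u x, before sigma x v & before sigma v y]].

Definition nests (T : finType) (sigma : rel T) (e f : {set T}) : Prop :=
  exists u v x y : T,
    [/\ e = [set u; v], f = [set x; y]
      & [/\ before sigma u x, before sigma x y & before sigma y v]].

Definition is_stack (T : finType) (sigma : rel T) (S : {set {set T}}) : Prop :=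
  forall e f : {set T}, e \in S -> f \in S -> ~ crosses sigma e f.

Definition is_queue (T : finType) (sigma : rel T) (Q : {set {set T}}) : Prop :=
  forall e f : {set T}, e \in Q -> f \in Q -> ~ nests sigma e f.

Definition is_matching (T : finType) (M : {set {set T}}) : Prop :=
  forall e f : {set T}, e \in M -> f \in M -> e != f -> [disjoint e & f].

(* As usual for layouts, some of the [k] parts may be empty. *)
Definition edge_partition (G : sgraph) (k : nat) (P : 'I_k -> {set {set G}}) :
    Prop :=
  (\bigcup_(i < k) P i = edges G) /\
  (forall i j : 'I_k, i != j -> [disjoint P i & P j]).

Definition stack_layout (G : sgraph) (k : nat) (sigma : rel G)
    (P : 'I_k -> {set {set G}}) : Prop :=
  [/\ vertex_order sigma, edge_partition P & forall i, is_stack sigma (P i)].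

Definition queue_layout (G : sgraph) (k : nat) (sigma : rel G)
    (P : 'I_k -> {set {set G}}) : Prop :=
  [/\ vertex_order sigma, edge_partition P & forall i, is_queue sigma (P i)].

Definition has_stack_layout (G : sgraph) (k : nat) : Prop :=
  exists (sigma : rel G) (P : 'I_k -> {set {set G}}), stack_layout sigma P.

Definition has_dispersable_layout (G : sgraph) (k : nat) : Prop :=
  exists (sigma : rel G) (P : 'I_k -> {set {set G}}),
    stack_layout sigma P /\ forall i, is_matching (P i).

Definition has_simultaneous_layout (G : sgraph) (s q : nat) : Prop :=
  exists (sigma : rel G) (P : 'I_s -> {set {set G}}) (Q : 'I_q -> {set {set G}}),
    stack_layout sigma P /\ queue_layout sigma Q.

Lemma has_dispersable_layout_card (G : sgraph) :
  has_dispersable_layout G #|edges G|.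
Proof.
exists (fun u v => enum_rank u <= enum_rank v), (fun i => [set enum_val i]).
split; last by move=> i e f; rewrite !inE => /eqP-> /eqP->; rewrite eqxx.
split.
- split; last by move=> u v; exact: leq_total.
  + by move=> u v /anti_leq /val_inj /enum_rank_inj.
  + by move=> v u w; exact: leq_trans.
- split.
  + apply/setP=> e; apply/bigcupP/idP => [[i _]|eG].
      by rewrite inE => /eqP->; exact: enum_valP.
    by exists (enum_rank_in eG e) => //; rewrite inE enum_rankK_in.
  + move=> i j ij; rewrite disjoints1 inE.
    by apply: contraNneq ij => /enum_val_inj->.
- move=> i e f; rewrite !inE => /eqP-> /eqP-> [u [v [x [y [-> euv]]]]].
  have : u \in [set x; y] by rewrite -euv set21.
  rewrite !inE => /orP[] /eqP-> [].
    by rewrite /before eqxx.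
  move=> /andP[_ yx] /andP[nxv xv] /andP[nvy vy].
  have xy := leq_trans xv vy.
  have xyE : x = y by apply/enum_rank_inj/val_inj/anti_leq; rewrite /= xy yx.
  move: nvy => /negP; apply; apply/eqP/enum_rank_inj/val_inj/anti_leq.
  by rewrite /= vy -xyE xv.
Qed.

Lemma has_stack_layout_card (G : sgraph) : has_stack_layout G #|edges G|.
Proof.
by have [sigma [P [layoutP _]]] := has_dispersable_layout_card G; exists sigma, P.
Qed.

Lemma ex_stack_layout (G : sgraph) : exists k, `[< has_stack_layout G k >].
Proof. by exists #|edges G|; apply/asboolP/has_stack_layout_card. Qed.

Lemma ex_dispersable_layout (G : sgraph) :
  exists k, `[< has_dispersable_layout G k >].
Proof. by exists #|edges G|; apply/asboolP/has_dispersable_layout_card. Qed.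

Definition sn (G : sgraph) : nat := ex_minn (ex_stack_layout G).

Definition dsn (G : sgraph) : nat := ex_minn (ex_dispersable_layout G).

Section Products.
Variables A B : sgraph.

(* An [A]-edge lies in a fibre over one vertex of [A]: it projects to an edge
   of [B], and symmetrically for a [B]-edge. *)
Definition A_edge : rel (A * B) := fun p r => (p.1 == r.1) && adj p.2 r.2.
Definition B_edge : rel (A * B) := fun p r => (p.2 == r.2) && adj p.1 r.1.
Definition direct_edge : rel (A * B) := fun p r => adj p.1 r.1 && adj p.2 r.2.

Lemma A_edge_sym : symmetric A_edge.
Proof. by move=> p r; rewrite /A_edge eq_sym adj_sym. Qed.
Lemma B_edge_sym : symmetric B_edge.
Proof. by move=> p r; rewrite /B_edge eq_sym adj_sym. Qed.
Lemma direct_edge_sym : symmetric direct_edge.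
Proof. by move=> p r; rewrite /direct_edge adj_sym [adj p.2 _]adj_sym. Qed.

Lemma A_edge_irrefl : irreflexive A_edge.
Proof. by move=> p; rewrite /A_edge adj_irrefl andbF. Qed.
Lemma B_edge_irrefl : irreflexive B_edge.
Proof. by move=> p; rewrite /B_edge adj_irrefl andbF. Qed.
Lemma direct_edge_irrefl : irreflexive direct_edge.
Proof. by move=> p; rewrite /direct_edge adj_irrefl. Qed.

Definition cartesian_adj : rel (A * B) := fun p r => A_edge p r || B_edge p r.
Definition strong_adj : rel (A * B) :=
  fun p r => [|| A_edge p r, B_edge p r | direct_edge p r].

Lemma cartesian_sym : symmetric cartesian_adj.
Proof. by move=> p r; rewrite /cartesian_adj A_edge_sym B_edge_sym. Qed.
Lemma cartesian_irrefl : irreflexive cartesian_adj.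
Proof. by move=> p; rewrite /cartesian_adj A_edge_irrefl B_edge_irrefl. Qed.

Lemma strong_sym : symmetric strong_adj.
Proof.
by move=> p r; rewrite /strong_adj A_edge_sym B_edge_sym direct_edge_sym.
Qed.
Lemma strong_irrefl : irreflexive strong_adj.
Proof.
by move=> p; rewrite /strong_adj A_edge_irrefl B_edge_irrefl direct_edge_irrefl.
Qed.

Definition cartesian_product : sgraph := SGraph cartesian_sym cartesian_irrefl.
Definition direct_product : sgraph := SGraph direct_edge_sym direct_edge_irrefl.
Definition strong_product : sgraph := SGraph strong_sym strong_irrefl.
End Products.

(* Main.v *)
(* Order the copies of [G] as a dispersable layout orders [H], and reverse the
   copies over one colour class of [H]. A copy of [G], reversed or not, keeps
   its [s] stacks. Two edges of the product over disjoint edges of one stack of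
   [H] do not cross; the reversal makes two edges over the same edge of [H]
   nest if they are [B]-edges, whereas if they are direct edges slanted the
   same way a crossing of them would give a nesting in [G]. *)
Require Import Defs.
From mathcomp Require Import all_boot.
From mathcomp Require Import boolp.

Set Implicit Arguments.
Unset Strict Implicit.
Unset Printing Implicit Defensive.

(** * Edges, strict orders, and stack layouts from colourings of ordered pairs *)

Lemma mem_edges (G : sgraph) (u v : G) : ([set u; v] \in edges G) = adj u v.
Proof.
apply/imsetP/idP => [[[a b]]|uv]; last by exists (u, v); rewrite ?inE.
rewrite inE /= => ab uvE.
have : u \in [set a; b] by rewrite -uvE set21.
have : v \in [set a; b] by rewrite -uvE set22.
have : a \in [set u; v] by rewrite uvE set21.
have : b \in [set u; v] by rewrite uvE set22.
rewrite !inE => bE aE /orP[]/eqP vE /orP[]/eqP uE.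
- by move: bE ab; rewrite uE vE orbb => /eqP->; rewrite adj_irrefl.
- by rewrite uE vE adj_sym.
- by rewrite uE vE.
- by move: aE ab; rewrite uE vE orbb => /eqP->; rewrite adj_irrefl.
Qed.

Section Before.
Variables (T : finType) (sigma : rel T).
Hypothesis orderT : vertex_order sigma.

Lemma before_asym u v : before sigma u v -> ~~ before sigma v u.
Proof.
case: orderT => asym _ _ /andP[uv suv]; apply/negP => /andP[_ svu].
by move: uv; rewrite (asym u v) ?eqxx // suv svu.
Qed.

Lemma before_trans v u w :
  before sigma u v -> before sigma v w -> before sigma u w.
Proof.
move=> uv vw; have := before_asym uv.
case: orderT uv vw => _ tr _ /andP[uv suv] /andP[vw svw].
rewrite /before (tr _ _ _ suv svw) andbT.
by case: (eqVneq u w) => // ->; rewrite vw svw.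
Qed.

Lemma before_total u v : u != v -> before sigma u v || before sigma v u.
Proof.
case: orderT => _ _ tot uv.
by rewrite /before (eq_sym v) uv /= tot.
Qed.

Lemma before_set2_inj u v x y : before sigma u v -> before sigma x y ->
  [set u; v] = [set x; y] -> u = x /\ v = y.
Proof.
move=> uv xy E.
have : u \in [set x; y] by rewrite -E set21.
have : v \in [set x; y] by rewrite -E set22.
rewrite !inE => /orP[]/eqP vE /orP[]/eqP uE //.
- by case/andP: uv; rewrite uE vE eqxx.
- by move: (before_asym uv); rewrite uE vE xy.
- by case/andP: uv; rewrite uE vE eqxx.
Qed.

End Before.

(** Ordered pairs replace two-element sets so that a colour class may depend on the direction in
    which an edge is read, as the slant of a direct edge does. *)
Definition uncrossed (T : finType) (sigma R : rel T) : Prop :=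
  forall u v x y, R u v -> R x y ->
    before sigma u x -> before sigma x v -> before sigma v y -> False.

(* [R c u v] only has to make sense when [u] comes before [v], and an edge may
   have several colours: one of them is picked. *)
Lemma sn_le_card_colours (G : sgraph) (C : finType) (sigma : rel G)
    (R : C -> rel G) :
  vertex_order sigma ->
  (forall u v, adj u v -> before sigma u v -> exists c, R c u v) ->
  (forall c, uncrossed sigma (R c)) ->
  sn G <= #|C|.
Proof.
move=> ord cover unc; rewrite /sn; case: ex_minnP => m _; apply; apply/asboolP.
pose colour (p : G * G) := [pick c | R c p.1 p.2].
(* [R c] need not be symmetric, so the two readings of an edge could get different colours. Keeping
   only the increasing reading gives each edge one colour, which makes the parts disjoint. *)
pose D (i : 'I_#|C|) := [set p : G * G | [&& adj p.1 p.2, before sigma p.1 p.2 &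
  colour p == Some (enum_val i : C)]].
pose P (i : 'I_#|C|) := [set [set p.1; p.2] | p in D i].
have memP i u v : before sigma u v -> [set u; v] \in P i -> (u, v) \in D i.
  move=> uv /imsetP[[a b] abD E]; move: (abD); rewrite inE /=.
  by case/and3P=> _ ab _; have [-> ->] := before_set2_inj ord uv ab E.
exists sigma, P; split=> //.
  split.
    apply/setP=> e; apply/bigcupP/idP => [[i _ /imsetP[[u v]]]|].
      by rewrite inE /= => /and3P[uv _ _] ->; rewrite mem_edges.
    have key u v : adj u v -> before sigma u v ->
        exists2 i, true & [set u; v] \in P i.
      move=> uv buv; case E : (colour (u, v)) => [c|].
        exists (enum_rank c) => //; apply/imsetP; exists (u, v) => //.
        by rewrite inE /= uv buv enum_rankK E /=.
      move: E; rewrite /colour; case: pickP => // none _.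
      by have [c] := cover _ _ uv buv; rewrite none.
    case/imsetP=> -[u v]; rewrite inE /= => uv ->.
    have neq_uv : u != v by apply: contraTneq uv => ->; rewrite adj_irrefl.
    have /orP[buv|bvu] := before_total ord neq_uv; first exact: key.
    by rewrite setUC; apply: key => //; rewrite adj_sym.
  move=> i j ij; rewrite disjoints_subset; apply/subsetP=> e eP; rewrite inE.
  case/imsetP: eP => -[u v]; rewrite inE /= => /and3P[_ uv /eqP cuv] ->.
  apply: contra ij => /(memP _ _ _ uv); rewrite inE /= cuv.
  by case/and3P=> _ _ /eqP[] /enum_val_inj ->.
move=> i e f eP fP [u [v [x [y [eE fE [ux xv vy]]]]]]; subst.
(* The crossing pattern itself puts [u] before [v] and [x] before [y], so both edges are read in the
   direction in which they were coloured. *)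
move: (memP _ _ _ (before_trans ord ux xv) eP).
move: (memP _ _ _ (before_trans ord xv vy) fP).
have colourR p : colour p = Some (enum_val i) -> R (enum_val i) p.1 p.2.
  by rewrite /colour; case: pickP => // c Rc [<-].
rewrite !inE => /and3P[_ _ /eqP/colourR Rxy] /and3P[_ _ /eqP/colourR Ruv].
exact: (unc (enum_val i) u v x y).
Qed.

Lemma mem_edge_partition (G : sgraph) k (P : 'I_k -> {set {set G}}) u v :
  edge_partition P -> adj u v -> exists i, [set u; v] \in P i.
Proof.
by case=> cover _; rewrite -mem_edges -cover => /bigcupP[i _ ?]; exists i.
Qed.

Lemma edge_partition_adj (G : sgraph) k (P : 'I_k -> {set {set G}}) i u v :
  edge_partition P -> [set u; v] \in P i -> adj u v.
Proof.
by case=> cover _ Pi; rewrite -mem_edges -cover; apply/bigcupP; exists i.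
Qed.

(** * The product order and the edges inside copies of [G] *)

Section Products.
Variables (H G : sgraph) (A : {set H}) (tau : rel H) (sigma : rel G).
Hypothesis bipA : forall u v : H, adj u v -> (u \in A) != (v \in A).
Hypothesis ordH : vertex_order tau.
Hypothesis ordG : vertex_order sigma.

Definition fibre_order (v : H) : rel G :=
  fun x y => if v \in A then sigma x y else sigma y x.

Definition product_order : rel (H * G) := fun p r =>
  if p.1 == r.1 then fibre_order p.1 p.2 r.2 else tau p.1 r.1.

Lemma product_orderP : vertex_order product_order.
Proof.
case: ordH ordG => [asymH trH totH] [asymG trG totG]; split.
- move=> [u x] [v y]; rewrite /product_order /fibre_order /= (eq_sym v).
  case: eqVneq => [->|uv tuv]; last by move: uv; rewrite (asymH _ _ tuv) eqxx.
  by case: ifP => _; last rewrite andbC; move/asymG->.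
- move=> [v y] [u x] [w z]; rewrite /product_order /fibre_order /=.
  case: (eqVneq u v) => [->|uv].
    by case: (eqVneq v w) => // _; case: ifP => _ a b;
      [exact: trG a b | exact: trG b a].
  case: (eqVneq v w) => [<-|vw]; first by rewrite (negPf uv).
  case: (eqVneq u w) => [<-|uw tuv tvw]; last exact: trH tuv tvw.
  by move=> tuv tvu; move: uv; rewrite (asymH u v) ?eqxx ?tuv.
- move=> [u x] [v y]; rewrite /product_order /fibre_order /= (eq_sym v).
  by case: eqVneq => [->|_]; [case: ifP | ].
Qed.

Lemma before_fst p r : before product_order p r -> p.1 = r.1 \/ before tau p.1 r.1.
Proof.
rewrite /before /product_order; case: eqVneq => //= _.
by case: eqVneq => [|_] ?; [left | right].
Qed.

Lemma before_fibre p r : p.1 = r.1 -> before product_order p r ->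
  if p.1 \in A then before sigma p.2 r.2 else before sigma r.2 p.2.
Proof.
case: p r => [u x] [v y] /= <-; rewrite /before /product_order /fibre_order /=.
by rewrite xpair_eqE !eqxx /= (eq_sym y); case: ifP.
Qed.

(** Each copy of [G] is an interval of the product order, so a crossing forces both edges into the
    same copy. There it is a crossing for [sigma], with the two edges exchanged if the copy is
    reversed. *)
Lemma uncrossed_A_edges (P : {set {set G}}) : is_stack sigma P ->
  uncrossed product_order
    (fun p r => (p.1 == r.1) && ([set p.2; r.2] \in P)).
Proof.
move=> stackP p r x y /andP[/eqP pr prP] /andP[/eqP xy xyP] px xr ry.
have px1 : p.1 = x.1.
  case: (before_fst px) (before_fst xr) => // tpx [xr1|txr].
    by rewrite pr xr1.
  by move: (before_asym ordH tpx); rewrite pr txr.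
have := before_fibre px1 px.
have := before_fibre (etrans (esym px1) pr) xr.
have := before_fibre (etrans (esym pr) (etrans px1 xy)) ry.
rewrite -pr -px1; case: ifP => _ ry2 xr2 px2.
  by apply: (stackP _ _ prP xyP); exists p.2, r.2, x.2, y.2.
apply: (stackP _ _ xyP prP); exists y.2, x.2, r.2, p.2.
by split=> //; rewrite setUC.
Qed.

(** * Edges of the product over a single matching stack of [H] *)

Section OverStack.
Variable M : {set {set H}}.
Hypothesis adjM : forall u v, [set u; v] \in M -> adj u v.
Hypothesis stackM : is_stack tau M.
Hypothesis matchM : is_matching M.

(** Two different edges of [M] are disjoint, so all three comparisons become strict in [tau] and the
    crossing projects to one inside [M]. If the projections are the same edge, both are read in
    increasing order and their ends agree. *)
Lemma crossing_over_stack p r x y :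
  [set p.1; r.1] \in M -> [set x.1; y.1] \in M ->
  before product_order p x -> before product_order x r ->
  before product_order r y -> p.1 = x.1 /\ r.1 = y.1.
Proof.
move=> prM xyM px xr ry.
have [E|ne] := eqVneq [set p.1; r.1] [set x.1; y.1].
  have lt a b : adj a.1 b.1 -> before product_order a b -> before tau a.1 b.1.
    by move=> ab /before_fst[eq_ab|//]; move: ab; rewrite eq_ab adj_irrefl.
  apply: (before_set2_inj ordH _ _ E); apply: lt; try exact: adjM.
    exact: before_trans product_orderP _ _ _ px xr.
  exact: before_trans product_orderP _ _ _ xr ry.
have dis := matchM prM xyM ne; exfalso.
have contact a : a \in [set p.1; r.1] -> a \in [set x.1; y.1] -> False.
  by move=> a1 a2; move: (disjointFr dis a1); rewrite a2.
apply: (stackM prM xyM); exists p.1, r.1, x.1, y.1; split=> //; split.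
- case: (before_fst px) => // E; case: (contact p.1); first exact: set21.
  by rewrite E set21.
- case: (before_fst xr) => // E; case: (contact r.1); first exact: set22.
  by rewrite -E set21.
- case: (before_fst ry) => // E; case: (contact r.1); first exact: set22.
  by rewrite E set22.
Qed.

(** The end copies lie over adjacent vertices of [H], hence are ordered oppositely. The left ends
    and the right ends of a crossing would then compare the same two vertices of [G] in contrary
    ways. *)
Lemma uncrossed_B_edges : uncrossed product_order
  (fun p r => (p.2 == r.2) && ([set p.1; r.1] \in M)).
Proof.
move=> p r x y /andP[/eqP pr prM] /andP[/eqP xy xyM] px xr ry.
have [px1 ry1] := crossing_over_stack prM xyM px xr ry.
have := before_fibre px1 px; have := before_fibre ry1 ry.
have := bipA (adjM prM); rewrite -pr -xy.
by case: ifP; case: ifP => // _ _ _ b1 b2; move: (before_asym ordG b1);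
  rewrite b2.
Qed.

(** [b] is the slant: whether the second coordinate rises from left end to right end. As the end
    copies are opposite, a crossing puts both projected ends of one edge on the outer side of those
    of the other; a common slant turns this into a nesting. *)
Lemma uncrossed_direct_edges (Q : {set {set G}}) (b : bool) :
  is_queue sigma Q -> (forall x y, [set x; y] \in Q -> adj x y) ->
  uncrossed product_order (fun p r =>
    [&& [set p.1; r.1] \in M, [set p.2; r.2] \in Q &
        before sigma p.2 r.2 == b]).
Proof.
move=> queueQ adjQ p r x y /and3P[prM prQ /eqP pr] /and3P[xyM xyQ /eqP xy].
move=> px xr ry.
have [px1 ry1] := crossing_over_stack prM xyM px xr ry.
have := before_fibre px1 px; have := before_fibre ry1 ry.
have := bipA (adjM prM).
have neq u v : [set u; v] \in Q -> u != v.
  by move/adjQ; apply: contraTneq => ->; rewrite adj_irrefl.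
have up := before_total ordG (neq _ _ prQ).
have uq := before_total ordG (neq _ _ xyQ).
rewrite pr in up; rewrite xy in uq.
have nest u v w z : [set u; v] \in Q -> [set w; z] \in Q ->
    before sigma u w -> before sigma w z -> before sigma z v -> False.
  by move=> uvQ wzQ *; apply: (queueQ _ _ uvQ wzQ); exists u, v, w, z.
have prQ' : [set r.2; p.2] \in Q by rewrite setUC.
have xyQ' : [set y.2; x.2] \in Q by rewrite setUC.
(* The cases are the slant and which end copy is reversed; changing either one exchanges the outer
   and inner edge of the nesting. *)
case: b pr xy up uq => /= pr xy up uq;
  case: ifP; case: ifP => // _ _ _ ry2 px2.
- exact: nest xyQ prQ _ _ _.
- exact: nest prQ xyQ _ _ _.
- exact: nest prQ' xyQ' _ _ _.
- exact: nest xyQ' prQ' _ _ _.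
Qed.

End OverStack.
End Products.

Theorem theorem1 (H G : sgraph) (s q : nat)
    (hH : bipartite H) (hG : has_simultaneous_layout G s q) :
  [/\ sn (cartesian_product H G) <= s + dsn H,
      sn (direct_product H G) <= 2 * q * dsn H
    & sn (strong_product H G) <= 2 * q * dsn H + s + dsn H].
Proof.
case: hH => A bipA.
case: hG => sigma [P [Q [[ordG partP stackP] [_ partQ queueQ]]]].
rewrite /dsn; case: ex_minnP => d /asboolP[tau [M [[ordH partM stackM] matchM]]] _.
have ord := product_orderP A ordH ordG.
have adjM i u v : [set u; v] \in M i -> adj u v by exact: edge_partition_adj.
pose RA i (p r : H * G) := (p.1 == r.1) && ([set p.2; r.2] \in P i).
pose RB i (p r : H * G) := (p.2 == r.2) && ([set p.1; r.1] \in M i).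
(* A colour is a slant, a queue of [G] and a stack of [H], whence the bound [2 * q * d]. *)
pose RD (c : bool * 'I_q * 'I_d) (p r : H * G) :=
  [&& [set p.1; r.1] \in M c.2, [set p.2; r.2] \in Q c.1.2 &
      before sigma p.2 r.2 == c.1.1].
pose RC c := match c with inl i => RA i | inr i => RB i end.
pose RS c := match c with inl c => RD c | inr c => RC c end.
have uncA i : uncrossed (product_order A tau sigma) (RA i).
  exact: uncrossed_A_edges.
have uncB i : uncrossed (product_order A tau sigma) (RB i).
  by apply: uncrossed_B_edges => // u v; exact: adjM.
have uncD c : uncrossed (product_order A tau sigma) (RD c).
  apply: uncrossed_direct_edges => //; first exact: adjM.
  by move=> x y; exact: edge_partition_adj.
have coverC (p r : H * G) : cartesian_adj p r -> exists c, RC c p r.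
  case/orP=> /andP[eq_pr pr].
    have [i iP] := mem_edge_partition partP pr.
    by exists (inl i); rewrite /= /RA eq_pr.
  have [i iM] := mem_edge_partition partM pr.
  by exists (inr i); rewrite /= /RB eq_pr.
have coverD (p r : H * G) : direct_edge p r -> exists c, RD c p r.
  case/andP=> pr1 pr2.
  have [i iM] := mem_edge_partition partM pr1.
  have [j jQ] := mem_edge_partition partQ pr2.
  by exists (before sigma p.2 r.2, j, i); rewrite /RD /= iM jQ eqxx.
split.
- apply: leq_trans (@sn_le_card_colours (cartesian_product H G) _ _ RC ord _ _) _.
  + by move=> p r /coverC.
  + by case.
  + by rewrite card_sum !card_ord.
- apply: leq_trans (@sn_le_card_colours (direct_product H G) _ _ RD ord _ _) _ => //.
  + by move=> p r /coverD.
  + by rewrite !card_prod card_bool !card_ord.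
- apply: leq_trans (@sn_le_card_colours (strong_product H G) _ _ RS ord _ _) _.
  (* Reassociating the disjunction splits the strong product into its cartesian and direct edges,
     which use separate colours, so the first two bounds add up. *)
  + move=> p r; rewrite /= /strong_adj orbA => /orP[/coverC|/coverD] [c Rc] _.
      by exists (inr c).
    by exists (inl c).
  + by case=> [c|[i|i]]; [exact: uncD | exact: uncA | exact: uncB].
  + by rewrite !card_sum !card_prod card_bool !card_ord addnA.
Qed.
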